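(* Let $p$ and $q$ be distinct odd primes. Then the number $E_1(2pq)$ of sporadic Reinhardt polygons with $n=2pq$ sides is the product of the Fermat quotients with base $2$ for $p$ and $q$: \[ E_1(2pq) = \frac{(2^{p-1}-1)(2^{q-1}-1)}{pq}. \]
   Context: The Fermat quotient of a prime $p$ with base $a$, where $p\nmid a$, is the integer $(a^{p-1}-1)/p$. A Reinhardt polygon is an equilateral convex polygon $P$ that may be inscribed in a Reuleaux polygon $R$ in such a way that every vertex of $R$ is a vertex of $P$. The line segments joining vertices of a Reinhardt $n$-gon at maximal distance from one another contain a star polygon whose angles have measures $k_i\pi/n$ with $k_i$ positive integers summing to $n$; listing these in the order of visitation along the star polygon gives a composition $[k_1,\ldots,k_\ell]$ of $n$ into an odd number $\ell$ of parts. Polygons are identified when one is obtained from the other by rotations and flips, so a Reinhardt $n$-gon is identified with the equivalence class of such a composition under the dihedral action (cyclic shifts and reversal of the parts); such a class is called a dihedral composition. Equivalently (Reinhardt's correspondence), a Reinhardt polynomial for $n$ is a polynomial $F(z)$ with $\deg F<n$, all coefficients in $\{-1,0,1\}$, nonzero coefficients alternating in sign, an odd number of nonzero coefficients, and divisible by the cyclotomic polynomial $\Phi_{2n}(z)$. A Reinhardt polynomial $F(z)=\pm\sum_{i=0}^{\ell}(-1)^i z^{k_i}$ with $k_0<k_1<\cdots<k_\ell$ corresponds to the dihedral composition $[k_1-k_0,k_2-k_1,\ldots,k_\ell-k_{\ell-1},n-k_\ell+k_0]$ of $n$. The Reinhardt polygons with $n$ sides (up to equivalence) are exactly the dihedral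 compositions of $n$ arising in this way. A Reinhardt $n$-gon is periodic if its composition consists of a composition of some divisor $m<n$ of $n$ into an odd number of parts, repeated $n/m$ times. It is sporadic if it is not periodic. $E_1(n)$ denotes the number of sporadic Reinhardt polygons with $n$ sides, counted as dihedral equivalence classes. *)

(* Defs.v *)
From HB Require Import structures.
From mathcomp Require Import all_boot all_order all_algebra all_field.
From mathcomp Require Import boolp.

Set Implicit Arguments.
Unset Strict Implicit.
Unset Printing Implicit Defensive.

Import Order.TTheory GRing.Theory Num.Theory.

Local Open Scope ring_scope.

(* The divisibility is over int, where %| is pseudo-divisibility; since
   'Phi_(2 * n) is monic, it amounts to divisibility in Z[z]. *)
Definition reinhardt_poly (n : nat) (F : {poly int}) : bool :=
  let nz := [seq a : int <- F | a != 0] in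
  [&& (size F <= n)%N,
      all (fun a : int => a \in [:: -1; 0; 1]) F,
      sorted (fun a b : int => a * b < 0) nz,
      odd (size nz)
    & 'Phi_(2 * n) %| F].

Local Open Scope nat_scope.

Definition exponents (F : {poly int}) : seq nat :=
  [seq i <- iota 0 (size F) | (F`_i != 0)%R].

(* With k_0 < ... < k_l the exponents of F, this is
   [k_1 - k_0; ...; k_l - k_(l-1); n - k_l + k_0]. *)
Definition composition_of_poly (n : nat) (F : {poly int}) : seq nat :=
  if exponents F is k0 :: ks then
    rcons (pairmap (fun j k => k - j) k0 ks) (n - last k0 ks + k0)
  else [::].

Definition is_composition (n : nat) (c : seq nat) : bool :=
  all (fun k => 0 < k) c && (sumn c == n).

Definition dihedral_equiv (c d : seq nat) : bool :=
  [exists i : 'I_(size c).+1, (d == rot i c) || (d == rev (rot i c))].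

(* Reinhardt n-gons, up to rotations and flips, are identified with the
   dihedral classes of compositions of n given by the Reinhardt polynomials
   for n (Reinhardt's correspondence). *)
Definition reinhardt (n : nat) (c : seq nat) : Prop :=
  is_composition n c /\
  exists2 F : {poly int},
    reinhardt_poly n F & dihedral_equiv c (composition_of_poly n F).

Definition periodic (n : nat) (c : seq nat) : Prop :=
  exists m : nat, exists b : seq nat,
    [/\ m < n, m %| n, is_composition m b, odd (size b)
      & c = flatten (nseq (n %/ m) b)].

Definition sporadic (n : nat) (c : seq nat) : Prop :=
  reinhardt n c /\ ~ periodic n c.

(* A composition of n has at most n parts, each at most n, so the finite type
   n.-bseq 'I_n.+1 contains all of them. *)
Definition parts (n : nat) (c : n.-bseq 'I_n.+1) : seq nat :=
  [seq val k | k <- c].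

Definition sporadic_set (n : nat) : {set n.-bseq 'I_n.+1} :=
  [set c | `[< sporadic n (parts c) >]].

Definition E1 (n : nat) : nat :=
  #|equivalence_partition
      (fun c d : n.-bseq 'I_n.+1 => dihedral_equiv (parts c) (parts d))
      (sporadic_set n)|.

(* The division is exact when p is prime and does not divide a. *)
Definition fermat_quotient (a p : nat) : nat := (a ^ p.-1 - 1) %/ p.

(* Main.v *)
Require Import Defs.
From HB Require Import structures.
From mathcomp Require Import all_boot all_order all_algebra all_field.
From mathcomp Require Import boolp zify ring.
Set Implicit Arguments.
Unset Strict Implicit.
Unset Printing Implicit Defensive.
Import Order.TTheory GRing.Theory Num.Theory.

(** Fix n = 2pq. Going once around an equilateral polygon, a composition
    [k_1; ...; k_l] of n places l break points on a cycle of length n, at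
    distances k_1, ..., k_l. A Reinhardt polynomial F has the break points as
    its exponents. As l is odd and the signs of F alternate, F is, up to a
    global sign and after negacyclic extension F_(i+n) = - F_i, the difference
    sequence e(i+1) - e(i) of a colouring e of Z/2n by two colours with
    e(x + n) = ~~ e x ([telescope], [path_alternating], [alternating_path]).
    Rotating or flipping the composition amounts to applying to e a map
    x |-> k + x or x |-> k - x of Z/2n ([dihedral_encodes]); the shift by n
    exchanges the colours, which the composition does not see. So E_1(n)
    counts orbits of colourings under a dihedral group of order 4n.

    Divisibility by the cyclotomic polynomial is elementary in terms of e.
    The roots w of X^n + 1 that are not primitive 2n-th roots of unity are the
    ones that satisfy w^(2p) = -1 or w^(2q) = -1 ([negacyclic_root]); hence
    Phi_(2n) divides F if and only if X^n + 1 divides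
    F (1 + X^(2p)) (1 + X^(2q)), which says that each of the sets
    {x, x + 2p, x + 2q, x + 2p + 2q} contains two points of either colour
    ([balanced_jump_sum], [jump_sum_balanced], [reinhardtP]). Periodicity of
    the composition means e(x + 2p) = ~~ e x for all x, or the same with q
    ([periodicP]).

    In a balanced colouring, e(x + 2p) = e x and e(y + 2q) = e y cannot both
    hold when x and y have the same parity ([balanced_parity]). A sporadic
    colouring therefore satisfies e(x + 2p) = ~~ e x on one parity class and
    e(x + 2q) = ~~ e x on the other ([sporadic_halves]). Such a half is the
    same thing as a function on Z/p, respectively Z/q, and the colouring is
    sporadic exactly when neither function is constant; this gives
    2 (2^p - 2) (2^q - 2) sporadic colourings ([card_sporadic_patterns]). The
    dihedral group of order 4n = 8pq acts freely on them ([no_rotation],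
    [no_reflection]), so the number of orbits is
    (2^(p-1) - 1) (2^(q-1) - 1) / (pq). *)

Local Open Scope nat_scope.

(** * Compositions as binary words *)

Definition word (c : seq nat) : seq bool :=
  flatten [seq true :: nseq k.-1 false | k <- c].

Lemma word_cat c d : word (c ++ d) = word c ++ word d.
Proof. by rewrite /word map_cat flatten_cat. Qed.

Lemma word_cons k c : word (k :: c) = true :: nseq k.-1 false ++ word c.
Proof. by []. Qed.

Lemma size_word c : all (fun k => 0 < k) c -> size (word c) = sumn c.
Proof.
elim: c => //= k c IH /andP[k0 c0].
by rewrite size_cat size_nseq IH // -addSn prednK.
Qed.

Lemma count_word c : count id (word c) = size c.
Proof.
elim: c => //= k c IH; rewrite count_cat IH.
by rewrite (eq_in_count (a2 := pred0)) ?count_pred0 // => b /nseqP[->].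
Qed.

(** Each run of a word starts with its break point, so reversal puts the break
    points at the ends of the runs; moving one letter around the cycle repairs
    this. *)
Lemma word_rev c : rcons (word (rev c)) true = true :: rev (word c).
Proof.
elim: c => // k c IH; rewrite rev_cons -[rcons (rev c) k]cats1 word_cat.
rewrite word_cons /= rev_cons rev_cat rev_nseq cats0 -[true :: nseq _ _]cat1s.
by rewrite catA cats1 IH /= rcons_cat.
Qed.

Lemma word_rot i c : all (fun k => 0 < k) c ->
  word (rot i c) = rot (sumn (take i c)) (word c).
Proof.
move=> c0; have/size_word <- : all (fun k => 0 < k) (take i c).
  by apply/allP=> k /mem_take; apply: (allP c0).
have -> : word c = word (take i c) ++ word (drop i c).
  by rewrite -word_cat cat_take_drop.
by rewrite /rot word_cat drop_size_cat // take_size_cat.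
Qed.

Lemma word_inj c d : all (fun k => 0 < k) c -> all (fun k => 0 < k) d ->
  word c = word d -> c = d.
Proof.
elim: c d => [|[|k] c IH] [|[|l] d] //= c0 d0 [].
suff H : nseq k false ++ word c = nseq l false ++ word d ->
         k = l /\ word c = word d by move=> /H[-> /(IH _ c0 d0) ->].
elim: k l {c0 d0} => [|k IHk] [|l] //=.
- by case: (c).
- by case: (d).
by case=> /IHk[-> ->].
Qed.

Lemma wordP (s : seq bool) : head true s ->
  exists c, all (fun k => 0 < k) c /\ word c = s.
Proof.
suff [a [c [c0 ->]]] :
    exists a c, all (fun k => 0 < k) c /\ s = nseq a false ++ word c.
  by case: a => // _; exists c.
elim: s => [|[] s [a [c [c0 ->]]]]; first by exists 0, [::].
  by exists 0, (a.+1 :: c).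
by exists a.+1, c.
Qed.

Lemma nth_word_true c k : all (fun k => 0 < k) c -> nth false (word c) k ->
  exists2 j, j < size c & k = sumn (take j c).
Proof.
elim: c k => [|[|a] c IH] //= k; first by rewrite nth_nil.
case: k => [|k] /= c0; first by exists 0.
rewrite nth_cat size_nseq nth_nseq; case: ltnP => // ak /(IH _ c0)[j jc E].
by exists j.+1 => //=; rewrite -E addSn subnKC.
Qed.

(** This evaluates the word of the list of gaps that [composition_of_poly]
    builds. The last break point so far is [j], the positions between [j] and
    [b] carry none, and the final run is prolonged by [r], the part of the
    cycle that precedes the first exponent. *)
Lemma word_gaps (P : pred nat) j b m r : j < b ->
  let ks := [seq i <- iota b m | P i] in
  word (rcons (pairmap (fun j k => k - j) j ks) (b + m - last j ks + r)) =
  true :: nseq (b - j.+1) false ++ [seq P i | i <- iota b m] ++ nseq r false.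
Proof.
elim: m j b => [|m IH] j b jb /=.
  by rewrite /word /= addn0 cats0 -nseqD; congr (_ :: nseq _ _); lia.
case Pb: (P b) => /=.
  rewrite word_cons -addSnnS IH //= subnn /=; congr (_ :: nseq _ _ ++ _); lia.
rewrite -addSnnS IH; last lia.
have -> : b.+1 - j.+1 = (b - j.+1).+1 by lia.
by rewrite -addn1 nseqD -catA.
Qed.

(** * The break points of a composition on a cycle *)

Section Marks.

Variable n : nat.
Hypothesis n_gt0 : 0 < n.

Local Notation Z := 'Z_(2 * n).

Lemma double_gt1 : 1 < 2 * n. Proof. by lia. Qed.

Lemma val_natZ (i : nat) : (i%:R : Z)%R = i %% (2 * n) :> nat.
Proof. exact: val_Zp_nat double_gt1 _. Qed.

Lemma natZP (x : Z) : exists2 i, i < 2 * n & x = (i%:R)%R.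
Proof.
exists (x : nat); last by rewrite natr_Zp.
by rewrite -{2}(Zp_cast double_gt1) ltn_ord.
Qed.

Lemma modn_natZ (i : nat) : (i%:R : Z)%R %% n = i %% n.
Proof. by rewrite val_natZ modn_dvdm ?dvdn_mull. Qed.

Lemma natZ0 : ((2 * n)%:R = 0 :> Z)%R.
Proof. exact: pchar_Zp double_gt1. Qed.

(** The break points are a subset of Z/n, read here on Z/2n, where the
    colourings of the next part live. *)
Definition mark (c : seq nat) (x : Z) : bool := nth false (word c) (x %% n).

Lemma mark_nat c i : mark c (i%:R)%R = nth false (word c) (i %% n).
Proof. by rewrite /mark modn_natZ. Qed.

Lemma mark_modn c (x y : Z) : x = y %[mod n] -> mark c x = mark c y.
Proof. by rewrite /mark => ->. Qed.

Lemma composition_pos c : is_composition n c -> all (fun k => 0 < k) c.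
Proof. by case/andP. Qed.

Lemma size_word_composition c : is_composition n c -> size (word c) = n.
Proof. by case/andP=> c0 /eqP <-; apply: size_word. Qed.

Lemma mark0 c : is_composition n c -> mark c 0%R.
Proof.
move=> Hc; rewrite -(mulr0n 1%R) mark_nat mod0n.
by case: c Hc => // /andP[_ /eqP n0]; have := n_gt0; rewrite -n0.
Qed.

Lemma nth_rot_mod (s : seq bool) k i : size s = n -> k <= n ->
  nth false (rot k s) (i %% n) = nth false s ((i + k) %% n).
Proof.
move=> sz kn; rewrite -modnDml; have := ltn_pmod i n_gt0.
move: (i %% n) => {}i lin.
rewrite /rot nth_cat size_drop sz nth_drop; case: ltnP => [lt|le].
  rewrite modn_small; last by lia.
  by rewrite addnC.
rewrite nth_take; last by lia.
have -> : i + k = i - (n - k) + n by lia.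
by rewrite modnDr modn_small //; lia.
Qed.

Lemma sumn_take_le j c : sumn (take j c) <= sumn c.
Proof. by rewrite -{2}(cat_take_drop j c) sumn_cat leq_addr. Qed.

Lemma mark_rot c j x : is_composition n c ->
  mark (rot j c) x = mark c (x + (sumn (take j c))%:R)%R.
Proof.
move=> Hc; have [i _ ->] := natZP x; rewrite -natrD !mark_nat word_rot ?composition_pos //.
rewrite nth_rot_mod ?size_word_composition //.
by case/andP: Hc => _ /eqP <-; apply: sumn_take_le.
Qed.

Lemma rot_composition c j : is_composition n c -> is_composition n (rot j c).
Proof.
case/andP=> c0 /eqP <-; have pc : perm_eq (rot j c) c by rewrite perm_rot.
by rewrite /is_composition (perm_all _ pc) c0 (perm_sumn pc) eqxx.
Qed.

Lemma rev_composition c : is_composition n c -> is_composition n (rev c).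
Proof.
by case/andP=> c0 /eqP <-; rewrite /is_composition all_rev c0 sumn_rev eqxx.
Qed.

Lemma mark_rev c x : is_composition n c -> mark (rev c) x = mark c (- x)%R.
Proof.
move=> Hc; rewrite /mark.
have: ((- x)%R + x) %% n = 0.
  have: (((- x)%R + x)%:R : Z)%R = 0%R by rewrite natrD !natr_Zp addNr.
  by move/(congr1 (fun y : Z => y %% n)); rewrite modn_natZ mod0n.
rewrite -modnDm; have := ltn_pmod x n_gt0; have := ltn_pmod (- x)%R n_gt0.
move: (x %% n) ((- x)%R %% n) => i j jn lin ij0.
have sz := size_word_composition Hc.
have szr := size_word_composition (rev_composition Hc).
have -> : nth false (word (rev c)) i = nth false (true :: rev (word c)) i.
  by rewrite -word_rev nth_rcons szr lin.
case: i lin ij0 => [|i] lin ij0 /=.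
  rewrite addn0 modn_small // in ij0; rewrite ij0.
  by have := mark0 Hc; rewrite /mark mod0n => ->.
rewrite nth_rev sz; last lia.
suff -> : j = n - i.+1 by [].
have : j + i.+1 = n; last lia.
case: (ltnP (j + i.+1) n) => H; first by rewrite modn_small // in ij0; lia.
move: ij0; rewrite -(subnK H) modnDr modn_small; lia.
Qed.

Lemma mark_inj c d : is_composition n c -> is_composition n d ->
  mark c =1 mark d -> c = d.
Proof.
move=> Hc Hd E; apply: word_inj; rewrite ?composition_pos //.
apply: (@eq_from_nth _ false); rewrite ?size_word_composition // => i lin.
by have := E (i%:R)%R; rewrite !mark_nat modn_small.
Qed.

Lemma mark_shift_rot c d k : is_composition n c -> is_composition n d ->
  (forall x, mark d x = mark c (k + x)%R) ->
  exists2 j, j <= size c & d = rot j c.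
Proof.
move=> Hc Hd E; have := mark0 Hd; rewrite E addr0 => /(nth_word_true (composition_pos Hc)).
case=> j /ltnW jc kE; exists j => //; apply: mark_inj => //; first exact: rot_composition.
move=> x; rewrite mark_rot // E -kE; apply: mark_modn.
have [i _ ->] := natZP x; have [l _ ->] := natZP k.
by rewrite modn_natZ -!natrD !modn_natZ modnDmr addnC.
Qed.

(** A rotation of the circle that carries the break points of [c] to those of
    [d] carries 0 to a break point, so it moves a whole number of parts. *)
Lemma dihedralP c d : is_composition n c -> is_composition n d ->
  reflect (exists k : Z, (forall x, mark d x = mark c (k + x)%R) \/
                         (forall x, mark d x = mark c (k - x)%R))
          (dihedral_equiv c d).
Proof.
move=> Hc Hd; apply: (iffP existsP) => [[i /orP[]/eqP ->]|[k [E|E]]].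
- exists ((sumn (take i c))%:R)%R; left=> x; rewrite mark_rot //.
  by rewrite addrC.
- exists ((sumn (take i c))%:R)%R; right=> x.
  by rewrite mark_rev ?rot_composition // mark_rot // addrC.
- have [j jc ->] := mark_shift_rot Hc Hd E.
  by exists (inord j); rewrite inordK ?eqxx.
have [||j jc ->] := @mark_shift_rot (rev c) d (- k)%R _ Hd; first exact: rev_composition.
  by move=> x; rewrite mark_rev // E opprD opprK.
rewrite size_rev in jc; exists (inord (size c - j)); rewrite inordK; last lia.
by rewrite -/(rotr j c) rev_rotr eqxx orbT.
Qed.

End Marks.

(** * Antiperiodic colourings *)

Section Patterns.

Variable n : nat.
Hypothesis n_gt0 : 0 < n.

Local Notation Z := 'Z_(2 * n).
Implicit Types (e : {ffun Z -> bool}) (c d : seq nat).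

Definition antiperiod (m : nat) e : Prop := forall x, e (x + m%:R)%R = ~~ e x.

Definition encodes e c : Prop := forall x, mark c x = e x (+) e (x + 1)%R.

(** The dihedral group of order 4n, as the set of maps x |-> k + x and
    x |-> k - x of Z/2n. *)
Definition act (g : bool * Z) e : {ffun Z -> bool} :=
  [ffun x => e (if g.1 then g.2 - x else g.2 + x)%R].

Definition same_orbit e e' : bool := [exists g, e' == act g e].

Lemma same_orbitP e e' : reflect (exists g, e' = act g e) (same_orbit e e').
Proof. by apply: (iffP existsP) => [[g /eqP ->]|[g ->]]; exists g. Qed.

Lemma same_orbit_refl e : same_orbit e e.
Proof.
by apply/same_orbitP; exists (false, 0%R); apply/ffunP=> x; rewrite ffunE /= add0r.
Qed.

Lemma same_orbit_sym e e' : same_orbit e e' -> same_orbit e' e.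
Proof.
case/same_orbitP=> [[[] k] ->]; apply/same_orbitP.
  by exists (true, k); apply/ffunP=> x; rewrite !ffunE /= opprB addrC subrK.
by exists (false, (- k)%R); apply/ffunP=> x; rewrite !ffunE /= addrA subrr add0r.
Qed.

Lemma same_orbit_trans e2 e1 e3 :
  same_orbit e1 e2 -> same_orbit e2 e3 -> same_orbit e1 e3.
Proof.
case/same_orbitP=> [[s k] ->] /same_orbitP[[t l] ->]; apply/same_orbitP.
exists (s (+) t, if s then k - l else k + l)%R; apply/ffunP=> x.
by rewrite !ffunE; case: s; case: t => /=; congr (e1 _); ring.
Qed.

(** The colour of [i] is the parity of the number of break points before [i];
    the total number is odd, so one turn around Z/n exchanges the colours. *)
Lemma telescope (w : nat -> bool) : (forall i, w (i + n) = w i) ->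
    odd (\sum_(i < n) w i) ->
  exists2 e, antiperiod n e &
    forall i : nat, w i = e (i%:R)%R (+) e (i.+1%:R)%R.
Proof.
move=> wn wodd; pose g i := odd (\sum_(j < i) w j).
have gS i : g i.+1 = g i (+) w i by rewrite /g big_ord_recr oddD oddb.
have gn i : g (i + n) = ~~ g i.
  elim: i => [|i IH]; first by rewrite /g big_ord0 /= wodd.
  by rewrite addSn !gS wn IH addNb.
have gN i : g (i %% (2 * n)) = g i.
  rewrite {2}(divn_eq i (2 * n)); elim: (_ %/ _) => // k ->.
  have -> l : k.+1 * (2 * n) + l = k * (2 * n) + l + n + n by ring.
  by rewrite !gn negbK.
pose e : {ffun Z -> bool} := [ffun x : Z => g x].
have eE i : e (i%:R)%R = g i by rewrite ffunE val_natZ // gN.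
exists e => [x|i]; last by rewrite !eE gS addKb.
by have [i _ ->] := natZP n_gt0 x; rewrite -natrD !eE.
Qed.

Lemma telescope_uniq e e' :
    (forall x, e x (+) e (x + 1)%R = e' x (+) e' (x + 1)%R) ->
  exists b, forall x, e' x = b (+) e x.
Proof.
move=> E; exists (e 0%R (+) e' 0%R) => x; have [i _ ->] := natZP n_gt0 x.
elim: i => [|i IH]; first by rewrite addbAC addbb.
rewrite -natr1 -[LHS](addKb (e' (i%:R)%R)) -E IH.
by rewrite -!addbA addKb.
Qed.

Lemma antiperiod_mul m e j x : antiperiod m e ->
  e (x + (j * m)%:R)%R = odd j (+) e x.
Proof.
move=> em; elim: j => [|j IH]; first by rewrite addr0.
by rewrite (mulSn j) natrD addrCA addrC em IH addNb.
Qed.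

Lemma antiperiod_diff_mod e (i : nat) : antiperiod n e ->
  (e (i%:R) (+) e (i.+1%:R) = e ((i %% n)%:R) (+) e ((i %% n).+1%:R))%R.
Proof.
move=> en; have E : i = i %% n + i %/ n * n by rewrite addnC -divn_eq.
rewrite -!natr1 {1 2}E natrD (addrAC _ _ 1%R) !(antiperiod_mul _ _ en).
by rewrite addbACA addbb.
Qed.

Lemma antiperiod_act m g e : antiperiod m e -> antiperiod m (act g e).
Proof.
case: g => [[] k] em x; rewrite !ffunE /=; last by rewrite addrA em.
by apply: negb_inj; rewrite negbK -(em (k - (x + m%:R))%R); congr (e _); ring.
Qed.

Lemma antiperiod_sign e : antiperiod n e -> act (false, n%:R)%R e =1 fun x => ~~ e x.
Proof. by move=> en x; rewrite ffunE /= addrC en. Qed.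

(** The break points determine the colouring up to exchanging the two colours,
    which for an antiperiodic colouring is the shift by [n]. *)
Lemma same_jumps_orbit e e' : antiperiod n e -> antiperiod n e' ->
  (forall x, e x (+) e (x + 1)%R = e' x (+) e' (x + 1)%R) -> same_orbit e e'.
Proof.
move=> en e'n /telescope_uniq[[] E]; apply/same_orbitP.
  by exists (false, n%:R)%R; apply/ffunP=> x; rewrite antiperiod_sign ?E.
by exists (false, 0)%R; apply/ffunP=> x; rewrite ffunE /= add0r E.
Qed.

Lemma act_shift_diff k e x :
  (act (false, k) e x (+) act (false, k) e (x + 1) =
   e (k + x) (+) e (k + x + 1))%R.
Proof. by rewrite !ffunE /= addrA. Qed.

(** A flip exchanges the two ends of each edge (x, x + 1), whence the
    correction by 1 in the centre of the flip. *)
Lemma act_flip_diff k e x :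
  (act (true, k + 1) e x (+) act (true, k + 1) e (x + 1) =
   e (k - x) (+) e (k - x + 1))%R.
Proof. by rewrite !ffunE /= addbC; congr (e _ (+) e _); ring. Qed.

(** The two notions of congruence agree: the one of compositions of [n] and
    the one of colourings of Z/2n. *)
Lemma dihedral_encodes c d e e' :
    is_composition n c -> is_composition n d ->
    antiperiod n e -> antiperiod n e' -> encodes e c -> encodes e' d ->
  dihedral_equiv c d = same_orbit e e'.
Proof.
move=> Hc Hd en e'n ec e'd; apply/(dihedralP n_gt0 Hc Hd)/idP => [[k [E|E]]|].
- apply: (@same_orbit_trans (act (false, k) e)).
    by apply/same_orbitP; exists (false, k).
  apply: same_jumps_orbit => // [|x]; first exact: antiperiod_act.
  by rewrite act_shift_diff -ec -E e'd.
- apply: (@same_orbit_trans (act (true, k + 1)%R e)).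
    by apply/same_orbitP; exists (true, k + 1)%R.
  apply: same_jumps_orbit => // [|x]; first exact: antiperiod_act.
  by rewrite act_flip_diff -ec -E e'd.
case/same_orbitP=> -[[] k] E.
  exists (k - 1)%R; right=> x.
  by rewrite ec e'd E -{1 2}(subrK 1%R k) act_flip_diff.
by exists k; left=> x; rewrite ec e'd E act_shift_diff.
Qed.

Lemma dihedral_transport c d e :
    is_composition n c -> is_composition n d -> dihedral_equiv c d ->
    encodes e d ->
  exists g, encodes (act g e) c.
Proof.
move=> Hc Hd /(dihedralP n_gt0 Hc Hd)[k [E|E]] ed.
  exists (false, - k)%R => x; rewrite act_shift_diff -ed E.
  by congr mark; ring.
by exists (true, k + 1)%R => x; rewrite act_flip_diff -ed E opprB addrC subrK.
Qed.

Lemma encodes_count c e m : is_composition n c -> encodes e c -> m <= n ->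
  odd (count id (take m (word c))) = e 0%R (+) e (m%:R)%R.
Proof.
move=> Hc ec mn.
have -> : count id (take m (word c)) = \sum_(0 <= i < m) mark c (i%:R : Z)%R.
  rewrite -sumn_count sumnE big_map (big_nth false) size_takel ?size_word_composition //.
    apply: eq_big_nat => i lim; rewrite nth_take // mark_nat // modn_small //.
    exact: leq_trans mn.
  by rewrite (size_word_composition Hc).
elim: {mn}m => [|i IH]; first by rewrite big_geq // addbb.
rewrite big_nat_recr //= oddD oddb IH ec natr1.
by rewrite -addbA addKb.
Qed.

(** A composition starts at a break point, so the colouring has first to be
    turned until a change of colour comes to lie between 0 and 1. *)
Lemma encodes_surj e : antiperiod n e ->
  exists c k, is_composition n c /\ encodes (act (false, k) e) c.
Proof.
move=> en; have [k ek] : exists k : Z, e k (+) e (k + 1)%R.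
  apply/existsP; apply/contraT => /existsPn E.
  have e0 i : e (i%:R)%R = e 0%R.
    by elim: i => // i IH; rewrite -natr1 -IH -[LHS](addKb (e (i%:R)%R))
       (negbTE (E _)) addbF.
  by have := en 0%R; rewrite add0r e0; case: (e _).
pose s := mkseq (fun i => act (false, k) e (i%:R)%R (+) act (false, k) e (i%:R + 1)%R) n.
have [|c [c0 cs]] := @wordP s.
  by rewrite -nth0 nth_mkseq // act_shift_diff addr0.
have Hc : is_composition n c.
  by rewrite /is_composition c0 -size_word // cs size_mkseq eqxx.
exists c, k; split=> // x; have [i _ ->] := natZP n_gt0 x.
rewrite mark_nat // cs nth_mkseq ?ltn_mod //.
have an := antiperiod_act (false, k) en.
move: (act _ e) an => {en s cs ek Hc c0 c}e en.
by rewrite natr1 -antiperiod_diff_mod // natr1.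
Qed.

End Patterns.

(** * The composition of a polynomial *)

(** The gaps are positive since the last break point so far, [j], lies before
    [b], and their sum telescopes. *)
Lemma gaps_composition (P : pred nat) j b m r : j < b ->
  let ks := [seq i <- iota b m | P i] in
  is_composition (b + m + r - j)
    (rcons (pairmap (fun j k => k - j) j ks) (b + m - last j ks + r)).
Proof.
rewrite /is_composition; elim: m j b => [|m IH] j b jb /=.
  by rewrite !addn0 addn_gt0 subn_gt0 jb /=; apply/eqP; lia.
rewrite -addSnnS; case Pb: (P b) => /=; last by apply: IH; lia.
have /andP[-> /eqP->] := IH b b.+1 (leqnn _).
by rewrite subn_gt0 jb andbT /=; apply/eqP; lia.
Qed.

Lemma filter_iota_cons (P : pred nat) b m k ks :
    [seq i <- iota b m | P i] = k :: ks ->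
  [/\ b <= k < b + m, P k, forall i, b <= i < k -> ~~ P i
    & ks = [seq i <- iota k.+1 (b + m - k.+1) | P i]].
Proof.
elim: m b => //= m IH b; case: ifP => [Pb [<- <-]|Pb /IH[H1 H2 H3 H4]].
  split=> //; [lia | by move=> i; lia | by rewrite addnS subSS addKn].
split=> //; [lia | | by rewrite -addSnnS].
move=> i /andP[]; rewrite leq_eqVlt => /predU1P[<-|bi] ik; first by rewrite Pb.
by apply: H3; rewrite bi.
Qed.

Section Composition.

Variable n : nat.
Hypothesis n_gt0 : 0 < n.
Local Notation Z := 'Z_(2 * n).

Lemma exponents_iota (F : {poly int}) : size F <= n ->
  exponents F = [seq i <- iota 0 n | (F`_i != 0)%R].
Proof.
move=> /subnKC <-; rewrite iotaD filter_cat [X in _ = _ ++ X](_ : _ = [::]) ?cats0 //.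
apply/eqP; rewrite -(negbK (_ == _)) -has_filter; apply/hasPn=> i.
by rewrite mem_iota => /andP[Fi _]; rewrite nth_default ?eqxx.
Qed.

(** The shift [k] is the smallest exponent, which the composition puts at 0. *)
Lemma composition_of_polyP (F : {poly int}) : size F <= n -> F != 0%R ->
  is_composition n (composition_of_poly n F) /\
  exists k : nat, forall i : nat,
    mark (composition_of_poly n F) (i%:R : Z)%R = (F`_((i + k) %% n) != 0)%R.
Proof.
move=> sF F0; rewrite /composition_of_poly exponents_iota //.
set P := fun i => _; case E: [seq i <- iota 0 n | P i] => [|k ks].
  have : (size F).-1 \in [seq i <- iota 0 n | P i].
    rewrite mem_filter mem_iota /P -lead_coefE lead_coef_eq0 F0 /=.
    by rewrite -size_poly_gt0 in F0; rewrite add0n prednK.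
  by rewrite E.
have [/= kn Pk P0 ->] := filter_iota_cons E; rewrite add0n in kn *.
have En : n = k.+1 + (n - k.+1) by lia.
split.
  have := @gaps_composition P k k.+1 (n - k.+1) k (ltnSn _).
  by rewrite -En addnK.
exists k => i; rewrite mark_nat // -modnDml.
have := ltn_pmod i n_gt0; move: (i %% n) => {}i lin.
rewrite {2}En word_gaps // subnn /=; set s := _ :: _.
have -> : s = [seq P i | i <- iota k (n - k)] ++ nseq k false.
  have -> : n - k = (n - k.+1).+1 by lia.
  by rewrite /= Pk.
rewrite nth_cat size_map size_iota; case: ltnP => H.
  by rewrite (nth_map 0) ?size_iota // nth_iota // modn_small ?[i + k]addnC //; lia.
have -> : i + k = i - (n - k) + n by lia.
rewrite modnDr modn_small ?nth_nseq; last by lia.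
by rewrite if_same; apply/esym/negbTE/P0; lia.
Qed.

End Composition.

Local Open Scope ring_scope.

(** * Alternating signs *)

Definition spin (b : bool) : int := if b then 1 else -1.

Section Alternation.

Variables (f : nat -> int) (e : nat -> bool) (s : int).
Hypothesis s_unit : s = 1 \/ s = -1.

Let jump i := s * ((e i.+1)%:Z - (e i)%:Z).

(** A sign sequence alternates if and only if it is, up to a global sign, the
    difference sequence of a 0-1 sequence. The head of the path is the last
    nonzero sign before position [k], which is determined by the colour
    [e k]. *)
Lemma alternating_path k m : (forall i, (k <= i < k + m)%N -> f i = jump i) ->
  path (fun a b : int => a * b < 0) (s * spin (e k))
    [seq a <- [seq f i | i <- iota k m] | a != 0].
Proof.
elim: m k => //= m IH k H; have -> : f k = jump k by apply: H; lia.
have /IH : forall i, (k.+1 <= i < k.+1 + m)%N -> f i = jump i.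
  by move=> i Hi; apply: H; lia.
rewrite /jump.
by case: s_unit => ->; case: (e k); case: (e k.+1).
Qed.

Lemma path_alternating k m :
    (forall i, (k <= i < k + m)%N -> f i \in [:: -1; 0; 1]) ->
    (forall i, (k <= i < k + m)%N -> (f i != 0) = e i (+) e i.+1) ->
    path (fun a b : int => a * b < 0) (s * spin (e k))
      [seq a <- [seq f i | i <- iota k m] | a != 0] ->
  forall i, (k <= i < k + m)%N -> f i = jump i.
Proof.
elim: m k => [|m IH] k H1 H2 /= H3 i Hi; first by lia.
have kin : (k <= k < k + m.+1)%N by lia.
have [fk rest] : f k = jump k /\ path (fun a b : int => a * b < 0) (s * spin (e k.+1))
      [seq a <- [seq f i | i <- iota k.+1 m] | a != 0].
  move: H3 (H1 k kin) (H2 k kin); rewrite !inE /jump.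
  case/boolP: (f k == 0) => [/eqP-> /= H3 _|/= _ /andP[]].
    by case: (e k) H3; case: (e k.+1) => //= H3 _; rewrite ?subrr mulr0.
  case: s_unit => ->; case: (e k); case: (e k.+1) => /= h1 h2 /orP[]/eqP E;
    by rewrite E in h1 h2 *.
case: (eqVneq i k) => [->//|ik]; apply: (IH k.+1) => //; last by lia.
  by move=> j Hj; apply: H1; lia.
by move=> j Hj; apply: H2; lia.
Qed.

End Alternation.

(** * Cyclotomic divisibility and evaluation at roots of unity *)

Local Notation pZtoC := (map_poly (intr : int -> algC)).

(** The cyclotomic polynomial is the minimal polynomial of [w] over the
    rationals, and pseudo-divisibility over the integers is divisibility over
    the rationals. *)
Lemma Cyclotomic_dvdE N (F : {poly int}) (w : algC) : N.-primitive_root w ->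
  ('Phi_N %| F) = root (pZtoC F) w.
Proof.
move=> pw; have ZQ (p : {poly int}) :
    pZtoC p = map_poly ratr (map_poly (intr : int -> rat) p).
  by rewrite -map_poly_comp; apply: eq_map_poly => a /=; rewrite ratr_int.
have [p [Ep monp pP]] := minCpolyP w.
rewrite -dvdp_rat_int ZQ pP; congr (_ %| _).
apply: (map_poly_inj (ratr : {rmorphism rat -> algC})).
by rewrite -ZQ (Cintr_Cyclotomic pw) -minCpoly_cyclotomic.
Qed.

Lemma sum_window (V : zmodType) (h : nat -> V) n k : (forall i, h (i + n)%N = h i) ->
  \sum_(i < n) h (i + k)%N = \sum_(i < n) h i.
Proof.
move=> hn; elim: k => [|k <-]; first by apply: eq_bigr => i _; rewrite addn0.
case: n hn => [|n] hn; first by rewrite !big_ord0.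
rewrite big_ord_recr [RHS]big_ord_recl addrC /=; congr (_ + _).
  by apply: eq_bigr => i _; rewrite addnS.
by rewrite -[RHS]hn; congr (h _); rewrite add0n [RHS]addnC addnS addSn.
Qed.

(** X^n + 1 has [n] distinct roots, too many for a nonzero polynomial of
    degree less than [n]. *)
Lemma negacyclic_coef0 n (g : nat -> algC) : (0 < n)%N ->
    (forall w : algC, w ^+ n = -1 -> \sum_(i < n) g i * w ^+ i = 0) ->
  forall i, (i < n)%N -> g i = 0.
Proof.
move=> n0 H; have [z pz] : {z : algC | (2 * n).-primitive_root z}.
  by apply: C_prim_root_exists; rewrite muln_gt0.
have zn : z ^+ n = -1.
  have /eqP : (z ^+ n) ^+ 2 = 1 by rewrite -exprM mulnC (prim_expr_order pz).
  rewrite sqrf_eq1 => /orP[|/eqP//]; rewrite -(prim_order_dvd pz) => /dvdn_leq; lia.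
pose P := \poly_(i < n) g i; suff P0 : P = 0.
  by move=> i lin; have := coef_poly n g i; rewrite -/P P0 coef0 lin.
(* The roots of X^n + 1 are the odd powers of z. *)
pose rs := [seq z ^+ (2 * j).+1 | j <- iota 0 n].
apply: contraTeq (leqnn n) => P0; rewrite -ltnNge.
have {1}<- : size rs = n by rewrite size_map size_iota.
apply: leq_trans (max_poly_roots P0 _ _) (size_poly _ _).
  apply/allP=> _ /mapP[j _ ->]; rewrite rootE horner_poly; apply/eqP/H.
  by rewrite -exprM mulnC exprM zn -signr_odd /= oddM.
rewrite map_inj_in_uniq ?iota_uniq // => i j; rewrite !mem_iota /= => lin ljn /eqP.
by rewrite (eq_prim_root_expr pz) !modn_small; [move/eqP; lia | lia | lia].
Qed.

Local Open Scope nat_scope.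

(** * Repeated compositions *)

Lemma word_flatten t b : word (flatten (nseq t b)) = flatten (nseq t (word b)).
Proof. by elim: t => //= t IH; rewrite word_cat IH. Qed.

Lemma nth_flatten_nseq (T : Type) (x0 : T) t (s : seq T) i : i < t * size s ->
  nth x0 (flatten (nseq t s)) i = nth x0 s (i %% size s).
Proof.
elim: t i => //= t IH i; rewrite mulSn nth_cat => H; case: ltnP => Hi.
  by rewrite modn_small.
by rewrite IH ?ltn_subLR // -{2}(subnK Hi) modnDr.
Qed.

(** Repetition makes the break points periodic modulo [m], so that shifting
    the colouring by [m] either fixes it or exchanges the colours. The first
    is excluded, as [n / m] such shifts exchange the colours. *)
Lemma repetition_antiperiod n m b (e : {ffun 'Z_(2 * n) -> bool}) :
    0 < n -> is_composition m b ->
    is_composition n (flatten (nseq (n %/ m) b)) -> 0 < n %/ m -> m %| n ->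
    antiperiod n e -> encodes e (flatten (nseq (n %/ m) b)) ->
  antiperiod m e.
Proof.
move=> n_gt0 Hb; set c := flatten _ => Hc t_gt0 mn en ec.
have [c' cE c'E] : exists2 c', c = b ++ c' & b ++ c' = c' ++ b.
  rewrite /c; case: (n %/ m) t_gt0 => // t _; exists (flatten (nseq t b)) => //.
  by elim: t => [|t IH]; rewrite ?cats0 //= -catA -IH.
have rc : rot (size b) c = c by rewrite cE rot_size_cat.
have tc : take (size b) c = b by rewrite cE take_size_cat.
have [|[] E] := @telescope_uniq n n_gt0 e (act (false, (sumn b)%:R)%R e).
- by move=> x; rewrite act_shift_diff -!ec (addrC _ x) -{1}tc -mark_rot ?rc.
- by case/andP: Hb E => _ /eqP-> E x; have := E x; rewrite ffunE /= addrC.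
case/andP: Hb E => _ /eqP-> E; have := en 0%R; rewrite add0r.
have Et t : e ((t * m)%:R)%R = e 0%R.
  elim: t => // t IH; rewrite -IH (mulSn t) natrD.
  by have := E (t * m)%:R%R; rewrite ffunE.
by rewrite -(Et (n %/ m)) divnK //; case: (e _).
Qed.

(** The repeated block consists of the parts that fill the first [m]
    positions. It has an odd number of parts because the colour differs at 0
    and at [m]. *)
Lemma antiperiod_repetition n t m c (e : {ffun 'Z_(2 * n) -> bool}) :
    0 < n -> t * m = n -> m < n ->
    is_composition n c -> antiperiod n e -> encodes e c -> antiperiod m e ->
  periodic n c.
Proof.
move=> n_gt0 tm mn Hc en ec em.
have mm (x : 'Z_(2 * n)) : mark c (x + m%:R)%R = mark c x.
  by rewrite !ec addrAC !em addbN addNb negbK.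
have [j jc mj] : exists2 j, j < size c & m = sumn (take j c).
  apply: nth_word_true (composition_pos Hc) _; have := mm 0%R.
  by rewrite add0r mark_nat // modn_small // mark0.
have b_pos : all (fun k => 0 < k) (take j c).
  by apply/allP=> k /mem_take; apply: (allP (composition_pos Hc)).
have wb : word (take j c) = take m (word c).
  have -> : word c = word (take j c) ++ word (drop j c).
    by rewrite -word_cat cat_take_drop.
  by rewrite take_size_cat // size_word.
have m_gt0 : 0 < m by rewrite lt0n; apply/eqP => m0; move: n_gt0; rewrite -tm m0; lia.
have Hb : is_composition m (take j c).
  by rewrite /is_composition -mj eqxx andbT.
exists m, (take j c); split=> //.
- by rewrite -tm dvdn_mull.
- rewrite -count_word wb (encodes_count n_gt0 Hc ec (ltnW mn)).
  by rewrite -[m%:R%R]add0r em; case: (e _).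
rewrite -tm mulnK //; apply: (mark_inj n_gt0 Hc).
  rewrite /is_composition sumn_flatten map_nseq sumn_nseq -mj mulnC tm eqxx andbT.
  by apply/allP=> k /flattenP[s /nseqP[-> _]]; apply: (allP (composition_pos Hb)).
move=> x; have [i _ ->] := natZP n_gt0 x.
have mk k l : mark c ((k * m + l)%:R : 'Z_(2 * n))%R = mark c (l%:R : 'Z_(2 * n))%R.
  elim: k => [|k IH]; first by rewrite mul0n add0n.
  by rewrite (mulSn k) -addnA natrD addrC mm IH.
have -> : mark c (i%:R : 'Z_(2 * n))%R = mark c ((i %% m)%:R : 'Z_(2 * n))%R.
  by rewrite -[RHS](mk (i %/ m)) -divn_eq.
have mdn : m %| n by rewrite -tm dvdn_mull.
have sz := size_word_composition Hb.
rewrite !mark_nat // word_flatten nth_flatten_nseq sz ?tm ?ltn_mod //.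
rewrite wb nth_take ?ltn_mod // (modn_dvdm _ mdn) modn_small //.
by apply: leq_trans (ltnW mn); rewrite ltn_mod.
Qed.

(** * Colourings of one parity class *)

Definition residue r (r_gt0 : 0 < r) i : 'I_r := Ordinal (ltn_pmod i r_gt0).

Definition constants r : {set {ffun 'I_r -> bool}} :=
  [set [ffun=> true]; [ffun=> false]].

Lemma constantsP r (f : {ffun 'I_r -> bool}) :
  reflect (exists b, f = [ffun=> b]) (f \in constants r).
Proof.
apply: (iffP set2P) => [[]->|[[] ->]]; by [exists true | exists false | left | right].
Qed.

Lemma card_nonconstants r : 0 < r -> #|~: constants r| = 2 ^ r - 2.
Proof.
move=> r_gt0; rewrite cardsCs setCK card_ffun card_bool card_ord cards2.
suff -> : ([ffun=> true] != [ffun=> false] :> {ffun 'I_r -> bool}) by [].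
apply/eqP => /ffunP/(_ (residue r_gt0 0)).
by rewrite !ffunE.
Qed.

Lemma odd_add2 i r : odd (i + 2 * r) = odd i.
Proof. by rewrite oddD (oddM 2) addbF. Qed.

Lemma mod4_flip i r : odd r -> (1 < (i + 2 * r) %% 4) = ~~ (1 < i %% 4).
Proof. lia. Qed.

(** Shifts by [2 * m] preserve parity and reach every residue modulo [r]. *)
Lemma residue_constant r m s (r_gt0 : 0 < r) (f : {ffun 'I_r -> bool}) :
    odd r -> 0 < m -> coprime r (2 * m) ->
    (forall i, odd i = s -> f (residue r_gt0 (i + 2 * m)) = f (residue r_gt0 i)) ->
  f \in constants r.
Proof.
move=> r_odd m_gt0 co H; apply/constantsP; exists (f (residue r_gt0 (s * r))).
apply/ffunP => x; rewrite ffunE.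
have Hk k : f (residue r_gt0 (s * r + k * (2 * m))) = f (residue r_gt0 (s * r)).
  elim: k => [|k IH]; first by rewrite addn0.
  rewrite mulSn [2 * m + _]addnC addnA H ?IH //.
  by rewrite mulnCA oddD oddM r_odd andbT mul2n odd_double addbF oddb.
have m2 : 0 < 2 * m by rewrite muln_gt0.
case: (egcdnP r m2) => km kn; rewrite gcdnC (eqP co) => E _.
rewrite -(Hk (x * km)); congr (f _); apply: val_inj => /=.
by rewrite -mulnA E mulnDr muln1 mulnA addnA -mulnDl modnMDl modn_small.
Qed.

(** A colouring of one parity class that is antiperiodic under [2 * r] is a
    function of the residue modulo [r], twisted by a fixed colouring that
    changes colour under that shift without changing the residue: the one that
    separates the two classes modulo 4 inside a parity class. *)
Lemma residue_pattern r s (r_gt0 : 0 < r) (e : nat -> bool) : odd r ->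
    (forall i, odd i = s -> e (i + 2 * r) = ~~ e i) ->
  exists f : {ffun 'I_r -> bool},
    forall i, odd i = s -> e i = (1 < i %% 4) (+) f (residue r_gt0 i).
Proof.
move=> r_odd H; pose h i := (1 < i %% 4) (+) e i.
have hr i k : odd i = s -> h (i + k * (2 * r)) = h i.
  move=> oi; elim: k => [|k IH]; first by rewrite addn0.
  rewrite mulSn [2 * r + _]addnC addnA -IH /h mod4_flip // H.
    by rewrite addNb addbN negbK.
  by rewrite mulnCA oddD oi mul2n odd_double addbF.
have hE i : odd i = s -> h i = h (i %% (2 * r)).
  move=> oi; rewrite [in LHS](divn_eq i (2 * r)) addnC hr //.
  by rewrite odd_mod ?oddM.
(* The representative of x modulo r in the given parity class. *)
pose lift (x : 'I_r) := if odd x == s then (x : nat) else x + r.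
exists [ffun x => h (lift x)] => i oi; rewrite ffunE.
set x := residue _ _.
have ol : odd (lift x) = s.
  rewrite /lift; case: eqP => //; rewrite oddD r_odd addbT.
  by case: (s); case: (odd x).
suff -> : h (lift x) = h i by rewrite /h addKb.
rewrite (hE _ ol) (hE _ oi); congr h; apply/eqP.
rewrite chinese_remainder ?coprime2n // !modn2 ol oi eqxx /=.
rewrite /lift /x /=; case: ifP => _; rewrite ?modnDr modn_mod //.
Qed.

(** * Transport of equivalence classes *)

(** A map that reflects the equivalence and meets every class induces a
    bijection between the sets of classes. *)
Lemma card_equivalence_partition_transfer (T U : finType) (D : {set T}) (Y : {set U})
    (R : rel T) (S : rel U) (f : T -> U) :
    equivalence_rel S -> {in D, forall c, f c \in Y} ->
    {in D &, forall c d, R c d = S (f c) (f d)} ->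
    {in Y, forall y, exists2 c, c \in D & S (f c) y} ->
  #|equivalence_partition R D| = #|equivalence_partition S Y|.
Proof.
move=> eqS fY RS fsurj.
pose h (A : {set T}) := [set y in Y | [exists c in A, S (f c) y]].
have hE c : c \in D -> h [set d in D | R c d] = [set y in Y | S (f c) y].
  move=> cD; apply/setP => y; rewrite !inE; case: (y \in Y) => //=.
  apply/exists_inP/idP => [[d]|cy]; last first.
    by exists c; rewrite // inE cD RS // (eqS y y (f c)).1.
  by rewrite inE => /andP[dD]; rewrite RS // => /(eqS _ _ y).2 ->.
have -> : equivalence_partition S Y = h @: equivalence_partition R D.
  apply/setP => B; apply/imsetP/imsetP => [[y yY ->]|[A /imsetP[c cD ->] ->]].
    have [c cD cy] := fsurj y yY.
    exists [set d in D | R c d]; first exact: imset_f.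
    by rewrite hE //; apply/setP => z; rewrite !inE ((eqS _ _ z).2 cy).
  by exists (f c); rewrite ?fY ?hE.
rewrite card_in_imset // => _ _ /imsetP[c cD ->] /imsetP[d dD ->].
rewrite !hE // => /setP/(_ (f d)); rewrite !inE fY // (eqS (f d) (f d) (f d)).1 /= => cd.
apply/setP => x; rewrite !inE; case xD: (x \in D) => //=.
by rewrite !RS // ((eqS _ _ (f x)).2 cd).
Qed.

(** * Reinhardt compositions for n = 2pq *)

Local Open Scope ring_scope.

(** Padding by zeros up to length [m] puts all polynomials of degree less than
    [m] on the same footing. *)
Lemma nonzero_coefs m (F : {poly int}) : (size F <= m)%N ->
  [seq a : int <- F | a != 0] = [seq a <- [seq F`_i | i <- iota 0 m] | a != 0].
Proof.
move=> sF; have <- : polyseq F ++ nseq (m - size F) 0 = [seq F`_i | i <- iota 0 m].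
  apply: (@eq_from_nth _ 0).
    by rewrite size_cat size_nseq size_map size_iota subnKC.
  move=> i; rewrite size_cat size_nseq subnKC // => lim.
  rewrite nth_cat (nth_map 0%N) ?size_iota // nth_iota // add0n.
  by case: ltnP => // ?; rewrite nth_nseq if_same nth_default.
rewrite filter_cat [X in _ ++ X](_ : _ = [::]) ?cats0 //.
by elim: (_ - _)%N => // k IH; rewrite /= eqxx.
Qed.

Section TwoPrimes.

Variables p q : nat.
Hypotheses (p_prime : prime p) (q_prime : prime q).
Hypotheses (p_odd : odd p) (q_odd : odd q).

Local Notation n := (2 * p * q)%N.
Local Notation Z := 'Z_(2 * n).
Implicit Types e : {ffun Z -> bool}.

Let p_gt0 : (0 < p)%N. Proof. exact: prime_gt0. Qed.
Let q_gt0 : (0 < q)%N. Proof. exact: prime_gt0. Qed.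

Let n_gt0 : (0 < n)%N. Proof. by rewrite !muln_gt0 p_gt0 q_gt0. Qed.

(** The cofactor of [g] in 4pq is odd, so it is 1 or divisible by p or q. *)
Lemma dvdn_4pq g : (g %| 2 * n -> ~~ (g %| n) ->
  [\/ g = 2 * n, g %| 2 * (2 * p) | g %| 2 * (2 * q)])%N.
Proof.
case/dvdnP=> m E gn.
have modd : odd m.
  apply: contraT => /negbTE me; case/negP: gn; apply/dvdnP; exists m./2.
  have m2 : (m = 2 * m./2)%N by rewrite mul2n -[LHS]odd_double_half me.
  by apply/eqP; rewrite -(eqn_pmul2l (isT : 0 < 2)%N) (mulnA 2 m./2) -m2 E.
case: (ltngtP m 1%N) => [|m1|m1]; [by case: m E modd | | by constructor 1; lia].
have [r r_prime rm] : exists2 r, prime r & (r %| m)%N.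
  by exists (pdiv m); rewrite ?pdiv_prime ?pdiv_dvd.
have r2 : (r %| 2)%N = false.
  apply/negbTE; rewrite dvdn_prime2 //; apply/eqP => r2.
  by rewrite r2 dvdn2 modd in rm.
have : (r %| 2 * (2 * p * q))%N by rewrite E dvdn_mulr.
case/dvdnP: rm E => m' -> E.
rewrite !(Euclid_dvdM _ _ r_prime) r2 /= (dvdn_prime2 r_prime p_prime).
rewrite (dvdn_prime2 r_prime q_prime) => /orP[]/eqP r_eq.
  constructor 3; apply/dvdnP; exists m'; apply/eqP.
  by rewrite -(eqn_pmul2l p_gt0); apply/eqP; move: E; rewrite r_eq; lia.
constructor 2; apply/dvdnP; exists m'; apply/eqP.
by rewrite -(eqn_pmul2l q_gt0); apply/eqP; move: E; rewrite r_eq; lia.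
Qed.

(** The order of [w] divides 4pq but not 2pq. If it is not 4pq then w^(4p) = 1
    or w^(4q) = 1, and 2pq is an odd multiple of 2p and of 2q. *)
Lemma negacyclic_root (w : algC) : w ^+ n = -1 ->
  [\/ (2 * n).-primitive_root w, w ^+ (2 * p) = -1 | w ^+ (2 * q) = -1].
Proof.
move=> wn; have w2n : w ^+ (2 * n) = 1 by rewrite mulnC exprM wn sqrrN expr1n.
have [|g pg gn] := prim_order_exists _ w2n; first by rewrite muln_gt0 n_gt0.
have [|gE|gp|gq] := dvdn_4pq gn.
- by rewrite (prim_order_dvd pg) wn eq_sym -subr_eq0 opprK -(natrD _ 1 1) pnatr_eq0.
- by constructor 1; rewrite -gE.
- constructor 2; have w1 : w ^+ (2 * (2 * p)) = 1.
    by apply/eqP; rewrite -(prim_order_dvd pg).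
  rewrite -wn (_ : n = q./2 * (2 * (2 * p)) + 2 * p)%N; last first.
    by have := odd_double_half q; rewrite q_odd -mul2n add1n => {1}<-; ring.
  by rewrite exprD (mulnC q./2) (exprM _ _ q./2) w1 expr1n mul1r.
constructor 3; have w1 : w ^+ (2 * (2 * q)) = 1.
  by apply/eqP; rewrite -(prim_order_dvd pg).
rewrite -wn (_ : n = p./2 * (2 * (2 * q)) + 2 * q)%N; last first.
  by have := odd_double_half p; rewrite p_odd -mul2n add1n => {1}<-; ring.
by rewrite exprD (mulnC p./2) (exprM _ _ p./2) w1 expr1n mul1r.
Qed.

(** The value at [x] of (1 + X^(2p)) (1 + X^(2q)) applied to [e] as an operator
    of shifts. *)
Definition corners e (x : Z) : nat :=
  e x + e (x + (2 * p)%:R)%R + e (x + (2 * q)%:R)%R +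
  e (x + (2 * p)%:R + (2 * q)%:R)%R.

Definition balanced e : Prop := forall x, corners e x = 2%N.

Definition jump e (x : Z) : int := (e (x + 1))%:Z - (e x)%:Z.

Definition jump_sum e (w : algC) : algC :=
  \sum_(i < n) (jump e (i%:R))%:~R * w ^+ i.

Lemma jump_antiperiod e x : antiperiod n e -> jump e (x + n%:R) = - jump e x.
Proof.
by move=> en; rewrite /jump addrAC !en; case: (e _); case: (e _).
Qed.

(** Multiplication by w^k is the shift by [k], as [w] is a root of X^n + 1 and
    the jumps are negacyclic. *)
Lemma jump_sum_shift e w k : antiperiod n e -> w ^+ n = -1 ->
  (\sum_(i < n) (jump e (i%:R + k%:R))%:~R * w ^+ i) * w ^+ k = jump_sum e w.
Proof.
move=> en wn; pose h i := (jump e (i%:R))%:~R * w ^+ i.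
rewrite -[RHS](@sum_window _ h n k) => [|i]; last first.
  by rewrite /h natrD jump_antiperiod // exprD wn mulrN1 rmorphN mulrNN.
by rewrite mulr_suml; apply: eq_bigr => i _; rewrite /h -mulrA -exprD natrD.
Qed.

(** The value at [w] of the jump polynomial times (1 + X^(2p)) (1 + X^(2q)):
    modulo X^n + 1 and up to a shift by 2p + 2q, the coefficients of this
    product are the differences of consecutive corner sums. *)
Lemma jump_sum_corners e w : antiperiod n e -> w ^+ n = -1 ->
  (\sum_(i < n) ((corners e (i%:R + 1))%:Z - (corners e (i%:R))%:Z)%:~R * w ^+ i)
     * w ^+ (2 * p + 2 * q) =
  jump_sum e w * (1 + w ^+ (2 * p)) * (1 + w ^+ (2 * q)).
Proof.
move=> en wn; pose s k := \sum_(i < n) (jump e (i%:R + k%:R))%:~R * w ^+ i.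
have sE k : s k * w ^+ k = jump_sum e w by apply: jump_sum_shift.
have -> : \sum_(i < n)
    ((corners e (i%:R + 1))%:Z - (corners e (i%:R))%:Z)%:~R * w ^+ i =
  s 0%N + s (2 * p)%N + s (2 * q)%N + s (2 * p + 2 * q)%N.
  rewrite /s -!big_split; apply: eq_bigr => i _ /=; rewrite -!mulrDl -!intrD.
  congr (_%:~R * _); rewrite /corners /jump !PoszD.
  rewrite (natrD _ (2 * p)%N (2 * q)%N) addr0 !addrA.
  by rewrite ![_ + 1 + _]addrAC; ring.
transitivity (s 0%N * w ^+ 0 * w ^+ (2 * p) * w ^+ (2 * q) +
    s (2 * p)%N * w ^+ (2 * p) * w ^+ (2 * q) +
    s (2 * q)%N * w ^+ (2 * q) * w ^+ (2 * p) +
    s (2 * p + 2 * q)%N * w ^+ (2 * p + 2 * q)).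
  by rewrite exprD; ring.
by rewrite !sE; ring.
Qed.

(** The factors 1 + w^(2p) and 1 + w^(2q) do not vanish at a primitive 2n-th
    root of unity, so the factor that does vanish is the jump sum. *)
Lemma balanced_jump_sum e w : antiperiod n e -> balanced e ->
  (2 * n).-primitive_root w -> jump_sum e w = 0.
Proof.
move=> en eb pw; have wn : w ^+ n = -1.
  have /eqP : (w ^+ n) ^+ 2 = 1 by rewrite -exprM mulnC (prim_expr_order pw).
  rewrite sqrf_eq1 => /orP[|/eqP//]; rewrite -(prim_order_dvd pw) => /dvdn_leq.
  by have := n_gt0; lia.
have nz r : prime r -> (r %| n)%N -> (2 * r < n)%N -> 1 + w ^+ (2 * r) != 0.
  move=> r_prime rn rlt; apply/eqP => /(congr1 (fun y => y - 1)).
  rewrite addrAC subrr add0r sub0r => H.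
  have : w ^+ (2 * (2 * r)) = 1 by rewrite mulnC exprM H sqrrN expr1n.
  move/eqP; rewrite -(prim_order_dvd pw) => /dvdn_leq.
  by have := prime_gt0 r_prime; lia.
have p2 := prime_gt1 p_prime; have q2 := prime_gt1 q_prime.
have := jump_sum_corners en wn; rewrite big1 ?mul0r => [/esym/eqP|i _]; last first.
  by rewrite !eb subrr mul0r.
rewrite !mulf_eq0 (negbTE (nz p _ _ _)) ?(negbTE (nz q _ _ _)) ?orbF ?mulnA //.
- by move/eqP.
- by rewrite dvdn_mull.
- by nia.
- by rewrite dvdn_mulr ?dvdn_mull.
by nia.
Qed.

(** The product with (1 + X^(2p)) (1 + X^(2q)) vanishes at all roots of
    X^n + 1, hence the corner sums are constant. Corner sums at [x] and
    [x + n] add up to 4, so the constant is 2. *)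
Lemma jump_sum_balanced e : antiperiod n e ->
  (forall w, (2 * n).-primitive_root w -> jump_sum e w = 0) -> balanced e.
Proof.
move=> en H.
have E4n (x : Z) : (corners e (x + n%:R)%R + corners e x = 4)%N.
  rewrite /corners !(addrAC _ n%:R) !en.
  by case: (e x); case: (e (x + _)); case: (e (x + _)); case: (e (x + _ + _)).
pose g (i : nat) : algC :=
  ((corners e (i%:R + 1))%:Z - (corners e (i%:R))%:Z)%:~R.
have E4 i : (i < n)%N -> g i = 0.
  apply: (negacyclic_coef0 n_gt0) => w wn; apply/eqP.
  have w0 : w != 0.
    apply/eqP=> w0; have /esym/eqP := wn.
    by rewrite w0 expr0n gtn_eqF ?n_gt0 // oppr_eq0 oner_eq0.
  rewrite -(mulIr_eq0 _ (mulIf (expf_neq0 (2 * p + 2 * q) w0))).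
  rewrite jump_sum_corners //.
  by case: (negacyclic_root wn) => [/H->|->|->]; rewrite ?mul0r // subrr ?mulr0 ?mul0r.
have E4S (i : nat) : (i <= n)%N -> corners e (i%:R) = corners e 0.
  elim: i => // i IH lin; rewrite -IH 1?ltnW // -natr1.
  by move/eqP: (E4 i lin); rewrite intr_eq0 subr_eq0 => /eqP[].
have E0 : corners e 0 = 2%N.
  by have := E4n 0; rewrite add0r E4S //; lia.
move=> x; have [i ilt ->] := natZP n_gt0 x; case: (leqP i n) => [/E4S->//|nlt].
have := E4n ((i - n)%:R); rewrite -natrD subnK 1?ltnW // (E4S (i - n)%N) ?E0; lia.
Qed.

Let spinE (b : bool) : spin b = -1 \/ spin b = 1.
Proof. by case: b; [right | left]. Qed.

(** The colouring is obtained by telescoping the support of [F]; alternation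
    of signs then makes [F] a difference sequence up to a global sign. *)
Lemma reinhardt_poly_balanced (F : {poly int}) : reinhardt_poly n F ->
  exists e, [/\ antiperiod n e, balanced e
    & forall i, (i < n)%N -> (F`_i != 0) = e (i%:R) (+) e (i.+1%:R)].
Proof.
case/and5P=> sF /allP F1 Falt Fodd PhiF.
have nzE := nonzero_coefs sF.
have [||e en eE] := @telescope n n_gt0 (fun i => F`_(i %% n) != 0).
- by move=> i; rewrite modnDr.
- rewrite (eq_bigr (fun i : 'I_n => nat_of_bool (F`_i != 0))); last first.
    by move=> i _; rewrite modn_small.
  rewrite nzE size_filter -sumn_count sumnE !big_map in Fodd.
  by rewrite -(big_mkord xpredT (fun i => nat_of_bool (F`_i != 0))) /index_iota subn0.
have eF i : (i < n)%N -> (F`_i != 0) = e (i%:R) (+) e (i.+1%:R).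
  by move=> lin; rewrite -eE modn_small.
exists e; split=> //.
have [s s1 Hs] : exists2 s : int, s = 1 \/ s = -1 &
    forall i, (i < n)%N -> F`_i = s * jump e (i%:R).
  case nzF : [seq a : int <- F | a != 0] Falt Fodd => [|a nz] //= Falt _.
  have a1 : a = 1 \/ a = -1.
    have : a \in [seq a : int <- F | a != 0] by rewrite nzF mem_head.
    rewrite mem_filter => /andP[a0 /F1].
    by rewrite !inE (negbTE a0) /= => /orP[]/eqP->; auto.
  (* The global sign for which a sign opposite to a precedes the first
     nonzero coefficient a. *)
  exists (- a * spin (e 0)) => [|i lin].
    by case: a1 => ->; case: (spinE (e 0)) => ->; auto.
  have := @path_alternating (nth 0 F) (fun i => e (i%:R)) (- a * spin (e 0)) _ 0 n.
  rewrite /jump natr1 => -> //.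
  - by case: a1 => ->; case: (spinE (e 0)) => ->; auto.
  - move=> j /= jn; case: (ltnP j (size F)) => H; first by apply: F1; apply: mem_nth.
    by rewrite nth_default.
  by rewrite -nzE nzF /= Falt andbT; case: a1 => ->; case: (spinE (e 0)) => ->.
apply: jump_sum_balanced => // w pw.
have := PhiF; rewrite (Cyclotomic_dvdE F pw) rootE.
rewrite (horner_coef_wide w (n := n)); last first.
  by apply: leq_trans (size_poly _ _) _.
move=> /eqP FX; apply/eqP; suff : jump_sum e w = s%:~R * 0.
  by rewrite mulr0 => ->.
rewrite -[X in _ * X]FX mulr_sumr; apply: eq_bigr => i _.
rewrite coef_map /= Hs // rmorphM !mulrA /=; congr (_ * _).
by rewrite -rmorphM; case: s1 => ->; rewrite ?mulrNN !mul1r.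
Qed.

Definition jump_poly e : {poly int} := \poly_(i < n) jump e (i%:R).

Lemma reinhardt_jump_poly e : antiperiod n e -> balanced e ->
  reinhardt_poly n (jump_poly e).
Proof.
move=> en eb; have sF : (size (jump_poly e) <= n)%N by apply: size_poly.
have cF i : (i < n)%N -> (jump_poly e)`_i = jump e (i%:R).
  by move=> lin; rewrite coef_poly lin.
have nzE := nonzero_coefs sF.
have pathF : path (fun a b : int => a * b < 0) (spin (e 0))
    [seq a : int <- jump_poly e | a != 0].
  rewrite nzE -[spin _]mul1r.
  apply: (@alternating_path _ (fun i => e (i%:R))); first by left.
  by move=> i /= lin; rewrite cF // mul1r /jump natr1.
apply/and5P; split=> //.
- apply/allP=> a /(nthP 0)[i]; move/leq_trans/(_ sF) => lin <-.
  by rewrite cF // /jump; case: (e _); case: (e _).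
- by case: [seq _ <- _ | _] pathF => //= a nz /andP[].
- rewrite nzE size_filter -sumn_count sumnE !big_map.
  have -> : iota 0 n = index_iota 0 n by rewrite /index_iota subn0.
  rewrite (_ : \sum_(0 <= i < n) _ =
      \sum_(0 <= i < n) (e (i%:R) (+) e (i.+1%:R)))%N; last first.
    apply: eq_big_nat => i lin; rewrite cF // /jump natr1.
    by case: (e _); case: (e _).
  suff -> i : odd (\sum_(0 <= j < i) (e (j%:R) (+) e (j.+1%:R))) = e 0 (+) e (i%:R).
    by have := en 0; rewrite add0r => ->; case: (e _).
  elim: i => [|i IH]; first by rewrite big_geq // addbb.
  by rewrite big_nat_recr //= oddD oddb IH -addbA addKb.
have [w pw] : {w : algC | (2 * n).-primitive_root w}.
  by apply: C_prim_root_exists; rewrite muln_gt0 n_gt0.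
rewrite (Cyclotomic_dvdE _ pw) rootE (horner_coef_wide w (n := n)); last first.
  by apply: leq_trans (size_poly _ _) _.
apply/eqP; rewrite -[RHS](balanced_jump_sum en eb pw); apply: eq_bigr => i _.
by rewrite coef_map /= cF.
Qed.

Lemma balanced_act g e : balanced e -> balanced (act g e).
Proof.
case: g => [[] k] eb x; last first.
  by rewrite -[RHS](eb (k + x)) /corners !ffunE /= !addrA.
rewrite -[RHS](eb (k - x - (2 * p)%:R - (2 * q)%:R)) /corners !ffunE /=.
set a := (2 * p)%:R; set b := (2 * q)%:R.
rewrite (_ : k - x - a - b + a + b = k - x); last by ring.
rewrite (_ : k - x - a - b + a = k - (x + b)); last by ring.
rewrite (_ : k - x - a - b + b = k - (x + a)); last by ring.
rewrite (_ : k - x - a - b = k - (x + a + b)); last by ring.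
case: (e (k - x)); case: (e (k - (x + a))); case: (e (k - (x + b)));
  by case: (e (k - (x + a + b))).
Qed.

Lemma reinhardtP c : is_composition n c ->
  reinhardt n c <-> exists e, [/\ antiperiod n e, balanced e & encodes e c].
Proof.
have n0 := n_gt0; move=> Hc; split.
  case=> _ [F FR]; have sF : (size F <= n)%N by case/and5P: FR.
  have F0 : F != 0.
    by apply/eqP=> F0; have /and5P[_ _ _] := FR; rewrite F0 polyseq0.
  have [Hd [k Ek]] := composition_of_polyP n0 sF F0.
  have [e [en eb eF]] := reinhardt_poly_balanced FR.
  set d := composition_of_poly n F in Hd Ek *; move=> cd.
  have [|g gc] := @dihedral_transport n n0 c d (act (false, k%:R) e) Hc Hd cd.
    move=> x; have [i _ ->] := natZP n0 x.
    rewrite Ek eF ?ltn_mod // act_shift_diff addrC -natrD natr1.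
    by rewrite -antiperiod_diff_mod.
  exists (act g (act (false, k%:R) e)).
  by split; [do 2 apply: antiperiod_act | do 2 apply: balanced_act | ].
case=> e [en eb ec]; have FR := reinhardt_jump_poly en eb.
have sF : (size (jump_poly e) <= n)%N by case/and5P: FR.
split=> //; exists (jump_poly e) => //.
have F0 : jump_poly e != 0.
  by apply/eqP=> F0; have /and5P[_ _ _] := FR; rewrite F0 polyseq0.
have [Hd [k Ek]] := composition_of_polyP n0 sF F0.
apply/(dihedralP n0 Hc Hd); exists (k%:R); left=> x.
have [i _ ->] := natZP n0 x; rewrite Ek ec coef_poly ltn_mod n0 addrC -natrD natr1.
rewrite antiperiod_diff_mod // /jump natr1.
by case: (e _); case: (e _).
Qed.

Local Open Scope nat_scope.

(** If the block has size [m], then [n / m] is odd and greater than 1, hence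
    divisible by p or q, and the antiperiod [m] can be enlarged to its odd
    multiple 2q or 2p. *)
Lemma periodicP c e : is_composition n c -> antiperiod n e -> encodes e c ->
  periodic n c <-> antiperiod (2 * p) e \/ antiperiod (2 * q) e.
Proof.
have n0 := n_gt0.
have p2 := prime_gt1 p_prime; have q2 := prime_gt1 q_prime.
move=> Hc en ec; split; last first.
  case=> [ep|eq].
    by apply: (@antiperiod_repetition _ q _ c e n0 _ _ Hc en ec ep); nia.
  by apply: (@antiperiod_repetition _ p _ c e n0 _ _ Hc en ec eq); nia.
case=> m [b [mn m_n Hb bodd cE]]; rewrite cE in Hc ec.
have m0 : 0 < m by apply: dvdn_gt0 m_n.
have t0 : 0 < n %/ m by rewrite divn_gt0 // ltnW.
have em := repetition_antiperiod n0 Hb Hc t0 m_n en ec.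
have tm := divnK m_n; set t := n %/ m in tm t0.
have todd : odd t.
  have := antiperiod_mul t 0%R em; rewrite tm en.
  by case: (odd t) (e _) => -[].
have step r s : r * s = n -> odd r -> 2 * m %| 2 * s -> antiperiod s e.
  move=> rs rodd; rewrite dvdn_pmul2l // => /dvdnP[t' sE] x.
  have : t * m = r * t' * m by rewrite tm -rs sE mulnA.
  move/eqP; rewrite eqn_pmul2r // => /eqP tE.
  by rewrite sE (antiperiod_mul _ _ em); move: todd; rewrite tE oddM => /andP[_ ->].
have [|| E | E | E] := @dvdn_4pq (2 * m).
- by rewrite dvdn_pmul2l.
- rewrite -tm dvdn_pmul2r //; apply/negP=> /dvdnP[k tE].
  by rewrite tE oddM andbF in todd.
- by lia.
- by left; apply: (step q) => //; ring.
by right; apply: (step p) => //; ring.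
Qed.

(** * The structure of sporadic colourings *)

Hypothesis p_neq_q : p <> q.

Lemma coprime_pq : coprime p q.
Proof. by rewrite prime_coprime // dvdn_prime2 //; apply/eqP. Qed.

Lemma odd_natZ (i : nat) : odd (i%:R : Z)%R = odd i.
Proof. by rewrite val_natZ ?n_gt0 // odd_mod ?oddM. Qed.

Lemma oddZD (x y : Z) : odd (x + y)%R = odd x (+) odd y.
Proof.
have [i _ ->] := natZP n_gt0 x; have [j _ ->] := natZP n_gt0 y.
by rewrite -natrD !odd_natZ oddD.
Qed.

Lemma oddZ_even (x : Z) k : odd (x + (2 * k)%:R)%R = odd x.
Proof. by rewrite oddZD odd_natZ oddM addbF. Qed.

Lemma oddZN (x : Z) : odd (- x)%R = odd x.
Proof.
have := oddZD (- x)%R x; rewrite addNr.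
by case: (odd x); case: (odd (- x)%R).
Qed.

Lemma even_natZ (x : Z) : odd x = false -> exists k, x = ((2 * k)%:R)%R.
Proof.
have [i _ ->] := natZP n_gt0 x; rewrite odd_natZ => oi; exists i./2.
by have -> : 2 * i./2 = i by rewrite mul2n -[RHS]odd_double_half oi.
Qed.

Definition sporadic_pattern e : Prop :=
  [/\ antiperiod n e, balanced e, ~ antiperiod (2 * p) e & ~ antiperiod (2 * q) e].

Definition halves (s : bool) e : Prop :=
  forall x : Z, e (x + (2 * (if odd x == s then p else q))%:R)%R = ~~ e x.

Lemma not_antiperiod m e : ~ antiperiod m e -> exists x, e (x + m%:R)%R = e x.
Proof.
move=> H; have /existsP[x /eqP ex] : [exists x, e (x + m%:R)%R == e x].
  apply: contra_notT H => /existsPn H x.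
  by have := H x; case: (e x); case: (e _).
by exists x.
Qed.

Lemma balanced_repeat_p e x : balanced e ->
  (e (x + (2 * p)%:R) = e x -> e (x + (2 * q)%:R + (2 * p)%:R) = e (x + (2 * q)%:R))%R.
Proof.
move=> /(_ x); rewrite /corners [(_ + (2 * q)%:R + _)%R]addrAC.
by case: (e x); case: (e (x + _)%R); case: (e (x + _)%R); case: (e (x + _ + _)%R).
Qed.

Lemma balanced_repeat_q e x : balanced e ->
  (e (x + (2 * q)%:R) = e x -> e (x + (2 * p)%:R + (2 * q)%:R) = e (x + (2 * p)%:R))%R.
Proof.
move=> /(_ x); rewrite /corners.
by case: (e x); case: (e (x + _)%R); case: (e (x + _)%R); case: (e (x + _ + _)%R).
Qed.

(** By balance, repetition under 2p spreads along shifts by 2q, and conversely.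
    If [x] and [y] had the same parity, such shifts would carry them to a
    common point, with three corners of the same colour. *)
Lemma balanced_parity e x y : balanced e ->
    e (x + (2 * p)%:R)%R = e x -> e (y + (2 * q)%:R)%R = e y -> odd x != odd y.
Proof.
move=> eb ex ey; apply/eqP => xy.
have Ex k : (e (x + (k * (2 * q))%:R + (2 * p)%:R) = e (x + (k * (2 * q))%:R))%R.
  elim: k => [|k IH]; first by rewrite addr0.
  by rewrite (mulSn k) addnC natrD addrA balanced_repeat_p.
have Ey k : (e (y + (k * (2 * p))%:R + (2 * q)%:R) = e (y + (k * (2 * p))%:R))%R.
  elim: k => [|k IH]; first by rewrite addr0.
  by rewrite (mulSn k) addnC natrD addrA balanced_repeat_q.
have [|d dE] := @even_natZ (y - x)%R; first by rewrite oddZD oddZN xy addbb.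
have [u [v uv]] : exists u v, u * q = v * p + 1.
  case: (egcdnP p q_gt0) => u v E _; exists u, v.
  by rewrite E gcdnC (eqP coprime_pq).
have E : (y + (d * v * (2 * p))%:R = x + (d * u * (2 * q))%:R)%R.
  have -> : y = (x + (2 * d)%:R)%R by rewrite -dE addrC subrK.
  rewrite -addrA -natrD; congr (_ + _%:R)%R.
  have -> : d * u * (2 * q) = 2 * d * (u * q) by ring.
  by rewrite uv; ring.
have := eb (x + (d * u * (2 * q))%:R)%R; rewrite /corners Ex.
have := Ey (d * v); rewrite E => ->.
by case: (e (x + _)%R); case: (e (x + _ + _ + _)%R).
Qed.

Lemma sporadic_halves e : sporadic_pattern e ->
  exists s, [/\ halves s e,
    exists2 x : Z, odd x = ~~ s & e (x + (2 * p)%:R)%R = e x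
    & exists2 x : Z, odd x = s & e (x + (2 * q)%:R)%R = e x].
Proof.
case=> en eb /not_antiperiod[x ex] /not_antiperiod[y ey].
have xy := balanced_parity eb ex ey.
exists (odd y); split; last by exists y.
  2: by exists x => //; move: xy; case: (odd x); case: (odd y).
move=> z; apply/eqP; apply: contraT => H.
have {}H r : r = (if odd z == odd y then p else q) -> e (z + (2 * r)%:R)%R = e z.
  by move=> ->; move: H; case: (e z); case: (e _).
case: eqP H => zy H; last first.
  by have := balanced_parity eb ex (H q erefl); move: xy zy; do 3!case: (odd _).
by have := balanced_parity eb (H p erefl) ey; rewrite zy eqxx.
Qed.

Lemma halves_p s e (x : Z) : halves s e -> odd x = s -> e (x + (2 * p)%:R)%R = ~~ e x.
Proof. by move=> /(_ x) + xs; rewrite xs eqxx. Qed.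

Lemma halves_q s e (x : Z) : halves s e -> odd x = ~~ s -> e (x + (2 * q)%:R)%R = ~~ e x.
Proof. by move=> /(_ x) + xs; rewrite xs; case: s xs. Qed.

(** [n] is an odd multiple of [2 * m], so modulo the period [4 * m] it is
    [2 * m]. *)
Lemma period_antiperiod r m e : odd r -> r * (2 * m) = n ->
  antiperiod n e -> (forall x, e (x + (2 * (2 * m))%:R) = e x)%R -> antiperiod (2 * m) e.
Proof.
move=> r_odd rm en e4 x; rewrite -en.
have eM k y : (e (y + (k * (2 * (2 * m)))%:R) = e y)%R.
  elim: k y => [|k IH] y; first by rewrite addr0.
  by rewrite (mulSn k) natrD addrA IH e4.
rewrite -(eM r./2 (x + (2 * m)%:R)%R) -addrA -natrD; congr (e (x + _%:R))%R.
by rewrite -rm -{2}(odd_double_half r) r_odd -mul2n add1n; ring.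
Qed.

(** The periods form a subgroup, generated by a divisor of 4pq. If it
    is proper, it divides 2pq, 4p or 4q. But 2pq is an antiperiod, and a period
    4p or 4q would make 2p or 2q an antiperiod. *)
Lemma no_rotation e (d : Z) : sporadic_pattern e ->
  (forall x, e (d + x) = e x)%R -> d = 0%R.
Proof.
case=> en _ ep eq; have [i i_lt ->] := natZP n_gt0 d => H.
have [->//|i_gt0] := posnP i.
have Hk k x : (e (x + (k * i)%:R) = e x)%R.
  elim: k => [|k IH]; first by rewrite addr0.
  by rewrite (mulSn k) natrD addrCA H.
pose g := gcdn i (2 * n).
have eg k x : (e (x + (k * g)%:R) = e x)%R.
  case: (egcdnP (2 * n) i_gt0) => u v uv _.
  have E : k * u * i = k * v * (2 * n) + k * g by rewrite -(mulnA k u) uv mulnDr mulnA.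
  have := Hk (k * u) x; rewrite E natrD (natrM _ (k * v)) (natZ0 n_gt0) mulr0.
  by rewrite add0r.
have gn : ~~ (g %| n).
  by apply/negP => /dvdnP[k nE]; have := eg k 0%R; rewrite -nE en; case: (e _).
have contra m r : odd r -> r * (2 * m) = n -> g %| 2 * (2 * m) -> antiperiod (2 * m) e.
  by move=> ro rm /dvdnP[k kE]; apply: (period_antiperiod ro rm en) => x; rewrite kE eg.
have [|gE|gp|gq] := dvdn_4pq _ gn; first exact: dvdn_gcdr.
- have : 2 * n %| i by rewrite -gE dvdn_gcdl.
  by move/dvdn_leq => /(_ i_gt0); rewrite leqNgt i_lt.
- by case: ep; apply: (contra p q) => //; ring.
by case: eq; apply: (contra q p) => //; ring.
Qed.

(** For odd [k] the reflection exchanges the two parity classes, whose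
    antiperiods differ. For [k = 2 * d] it exchanges d - p with d + p and d - q
    with d + q; all four points have the same parity, and one of the two pairs
    is separated by the antiperiod of that parity class. *)
Lemma no_reflection e (k : Z) : sporadic_pattern e -> ~ (forall x, e (k - x) = e x)%R.
Proof.
move=> es H; have [s [eh [x xs ex] _]] := sporadic_halves es.
case kodd : (odd k).
  have := @halves_p s e (k - x - (2 * p)%:R)%R eh.
  rewrite subrK H -addrA -opprD H ex !oddZD oddZN oddZ_even xs kodd.
  by case: (s) (e x) => -[] /(_ erefl).
have [d kE] := even_natZ kodd.
have contra r : (e (d%:R - r%:R + (2 * r)%:R) = ~~ e (d%:R - r%:R))%R -> False.
  rewrite -(H (d%:R - r%:R)%R) kE.
  have -> : ((2 * d)%:R - (d%:R - r%:R) = d%:R - r%:R + (2 * r)%:R :> Z)%R.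
    by rewrite !natrM; ring.
  by case: (e _).
have od r : odd r -> odd (d%:R - r%:R : Z)%R = ~~ odd d.
  by move=> ro; rewrite oddZD oddZN !odd_natZ ro addbT.
have [ds|ds] := eqVneq (odd d) (~~ s).
  by apply: (contra p); apply: (halves_p eh); rewrite od // ds negbK.
apply: (contra q); apply: (halves_q eh); rewrite od //.
by move: ds; case: (s); case: (odd d).
Qed.

Lemma act_inj e : sporadic_pattern e -> injective (fun g => act g e).
Proof.
move=> es [a k] [b l] /ffunP E.
have {}E x : (e (if a then k - x else k + x) = e (if b then l - x else l + x))%R.
  by have := E x; rewrite !ffunE.
have rot k' l' : (forall x, e (k' + x) = e (l' + x))%R -> k' = l'.
  move=> H; apply/eqP; rewrite -subr_eq0; apply/eqP; apply: (no_rotation es) => x.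
  by rewrite -addrA H addrA subrr add0r.
case: a b E => -[] E.
- congr pair; apply: rot => x; have := E (- x)%R; by rewrite !opprK.
- case: (@no_reflection e (k + l)%R es) => x.
  by have := E (x - l)%R; rewrite opprB addrA subrKC => ->.
- case: (@no_reflection e (k + l)%R es) => x.
  by have := E (x - k)%R; rewrite subrKC opprB => ->; congr (e _); ring.
congr pair; exact: rot.
Qed.

Lemma sporadic_act g e : sporadic_pattern e -> sporadic_pattern (act g e).
Proof.
case=> en eb ep eq; have [h eE] : exists h, e = act h (act g e).
  by apply/same_orbitP/same_orbit_sym/same_orbitP; exists g.
split; [exact: antiperiod_act | exact: balanced_act | |] => H.
  by apply: ep; rewrite eE; apply: antiperiod_act.
by apply: eq; rewrite eE; apply: antiperiod_act.
Qed.

(** * Counting sporadic colourings *)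

Definition sporadic_patterns : {set {ffun Z -> bool}} :=
  [set e | `[< sporadic_pattern e >]].

Lemma sporadic_patternsP e : reflect (sporadic_pattern e) (e \in sporadic_patterns).
Proof. by rewrite inE; apply: asboolP. Qed.

(** The colouring made of the halves of [residue_pattern] for p and for q; the
    boolean is the parity of the class that carries the antiperiod 2p. *)
Definition glue (t : bool * {ffun 'I_p -> bool} * {ffun 'I_q -> bool}) :
    {ffun Z -> bool} :=
  [ffun x : Z => (1 < x %% 4) (+)
     (if odd x == t.1.1 then t.1.2 (residue p_gt0 x) else t.2 (residue q_gt0 x))].

Lemma glue_nat t (i : nat) : glue t (i%:R)%R = (1 < i %% 4) (+)
  (if odd i == t.1.1 then t.1.2 (residue p_gt0 i) else t.2 (residue q_gt0 i)).
Proof.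
have val_residue r (r_gt0 : 0 < r) : r %| 2 * n ->
    residue r_gt0 (i%:R : Z)%R = residue r_gt0 i.
  by move=> rn; apply: val_inj; rewrite /= val_natZ ?modn_dvdm.
have pn : p %| 2 * n by rewrite dvdn_mull // dvdn_mulr // dvdn_mull.
have qn : q %| 2 * n by rewrite dvdn_mull // dvdn_mull.
have n4 : 4 %| 2 * n by rewrite -mulnA (mulnA 2 2) dvdn_mulr.
by rewrite ffunE odd_natZ !val_residue // val_natZ // modn_dvdm.
Qed.

Lemma residueD r (r_gt0 : 0 < r) i k : residue r_gt0 (i + k * r) = residue r_gt0 i.
Proof. by apply: val_inj; rewrite /= addnC modnMDl. Qed.

Lemma glue_halves t : halves t.1.1 (glue t).
Proof.
move=> x; have [i _ ->] := natZP n_gt0 x; rewrite odd_natZ -natrD !glue_nat.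
rewrite oddD oddM /= addbF.
by case: eqP => _; rewrite residueD mod4_flip // addNb.
Qed.

Lemma glue_antiperiod t : antiperiod n (glue t).
Proof.
move=> x; have [i _ ->] := natZP n_gt0 x; rewrite -natrD !glue_nat.
have -> : i + n = i + q * 2 * p by ring.
rewrite residueD.
have -> : i + q * 2 * p = i + p * 2 * q by ring.
rewrite residueD.
have -> : i + p * 2 * q = i + 2 * (p * q) by ring.
by rewrite oddD oddM addbF mod4_flip ?addNb // oddM p_odd.
Qed.

Lemma halves_balanced s e : halves s e -> balanced e.
Proof.
move=> eh x; rewrite /corners; have [xs|xs] := eqVneq (odd x) s.
  rewrite (addrAC x) !(halves_p eh) ?oddZ_even //.
  by case: (e x); case: (e (x + _)%R).
have {}xs : odd x = ~~ s by move: xs; case: (s); case: (odd x).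
rewrite !(halves_q eh) ?oddZ_even //.
by case: (e x); case: (e (x + _)%R).
Qed.

Lemma halves_both s e : halves s e -> halves (~~ s) e -> antiperiod (2 * p) e.
Proof.
move=> h h' x; have [xs|xs] := eqVneq (odd x) s; first exact: (halves_p h).
by apply: (halves_p h'); move: xs; case: (s); case: (odd x).
Qed.

Definition gluing_data : {set bool * {ffun 'I_p -> bool} * {ffun 'I_q -> bool}} :=
  setX (setX setT (~: constants p)) (~: constants q).

(** If the half for p also had antiperiod 2q, its function on Z/p would be
    invariant under 2q, hence constant. *)
Lemma glue_sporadic t : t \in gluing_data -> sporadic_pattern (glue t).
Proof.
case: t => [[s a] b]; rewrite in_setX in_setX !in_setC in_setT /= => /andP[a_nc b_nc].
split; [exact: glue_antiperiod | exact: halves_balanced (glue_halves (s, a, b)) | |] => H.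
- rewrite (residue_constant (s := ~~ s) (r_gt0 := q_gt0) q_odd p_gt0) // in b_nc.
    by rewrite coprime_sym coprimeMl coprime2n q_odd coprime_pq.
  move=> i oi; have := H (i%:R)%R; rewrite -natrD !glue_nat /= mod4_flip //.
  rewrite oddD oddM addbF oi; case: eqP => [|_]; first by case: (s).
  by rewrite addNb => /negb_inj/addbI.
rewrite (residue_constant (s := s) (r_gt0 := p_gt0) p_odd q_gt0) // in a_nc.
  by rewrite coprimeMr coprimen2 p_odd coprime_pq.
move=> i oi; have := H (i%:R)%R; rewrite -natrD !glue_nat /= mod4_flip //.
by rewrite oddD oddM addbF oi eqxx addNb => /negb_inj/addbI.
Qed.

(** A sporadic colouring determines which class has antiperiod 2p, since 2p is
    not an antiperiod of both. *)
Lemma glue_inj : {in gluing_data &, injective glue}.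
Proof.
move=> [[s a] b] [[s' a'] b'] Ht Ht' E.
have ss : s' = s.
  apply/eqP; apply: contraT => ss.
  have [_ _ H _] := glue_sporadic Ht; case: H.
  apply: (halves_both (glue_halves (s, a, b))); rewrite E.
  by have := glue_halves (s', a', b'); move: ss => /=; case: (s); case: (s').
rewrite {}ss in E *.
have {}E (i : nat) := congr1 (fun e : {ffun Z -> bool} => e (i%:R)%R) E.
have lift r (x : 'I_r) (r_gt0 : 0 < r) (b0 : bool) : odd r ->
    exists2 i, odd i = b0 & residue r_gt0 i = x.
  move=> r_odd; exists (if odd x == b0 then (x : nat) else x + r).
    by case: eqP => //; rewrite oddD r_odd; case: (odd x); case: b0.
  by apply: val_inj; case: eqP => _ /=; rewrite ?modnDr modn_small.
congr (_, _, _); apply/ffunP => x.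
  have [i oi <-] := lift p x p_gt0 s p_odd.
  by have := E i; rewrite !glue_nat oi /= eqxx => /addbI.
have [i oi <-] := lift q x q_gt0 (~~ s) q_odd.
by have := E i; rewrite !glue_nat oi /=; case: eqP => [|_ /addbI //]; case: (s).
Qed.

(** A constant function on Z/p would make 2q an antiperiod of the half for p,
    against the point of that half where 2q repeats the colour. *)
Lemma glue_surj e : sporadic_pattern e -> exists2 t, t \in gluing_data & e = glue t.
Proof.
move=> es; have [s [eh [x xs ex] [y ys ey]]] := sporadic_halves es.
have [|a aE] := @residue_pattern p s p_gt0 (fun i => e (i%:R)%R) p_odd.
  by move=> i oi; rewrite natrD (halves_p eh) ?odd_natZ.
have [|b bE] := @residue_pattern q (~~ s) q_gt0 (fun i => e (i%:R)%R) q_odd.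
  by move=> i oi; rewrite natrD (halves_q eh) ?odd_natZ.
exists (s, a, b); last first.
  apply/ffunP => z; have [i _ ->] := natZP n_gt0 z; rewrite glue_nat /=.
  case: eqP => oi; first exact: aE.
  by apply: bE; move: oi; case: (s); case: (odd i).
rewrite in_setX in_setX !in_setC in_setT /=.
apply/andP; split; apply/negP => /constantsP[c cE].
  have [i _ iE] := natZP n_gt0 y; move: ys ey; rewrite iE -natrD odd_natZ => oi.
  rewrite !aE ?odd_add2 // mod4_flip // cE !ffunE.
  by case: (_ < _); case: c {cE}.
have [i _ iE] := natZP n_gt0 x; move: xs ex; rewrite iE -natrD odd_natZ => oi.
rewrite !bE ?odd_add2 // mod4_flip // cE !ffunE.
by case: (_ < _); case: c {cE}.
Qed.

Lemma card_sporadic_patterns :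
  #|sporadic_patterns| = 2 * ((2 ^ p - 2) * (2 ^ q - 2)).
Proof.
have -> : sporadic_patterns = glue @: gluing_data.
  apply/setP => e.
  apply/sporadic_patternsP/imsetP => [/glue_surj[t]|[t /glue_sporadic + ->]//].
  by exists t.
rewrite card_in_imset; last exact: glue_inj.
by rewrite !cardsX cardsT card_bool !card_nonconstants // mulnA.
Qed.

Lemma sporadicP c : is_composition n c ->
  sporadic n c <-> exists2 e, sporadic_pattern e & encodes e c.
Proof.
move=> Hc; rewrite /sporadic; split=> [[/(reinhardtP Hc)[e [en eb ec]]]|].
  rewrite (periodicP Hc en ec) => H; exists e => //.
  by split=> // H'; apply: H; [left | right].
case=> e [en eb ep eq] ec; split; first by apply/reinhardtP => //; exists e.
by rewrite (periodicP Hc en ec) => -[].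
Qed.

Lemma same_orbit_equivalence : equivalence_rel (@same_orbit n).
Proof.
move=> x y z; split; first exact: same_orbit_refl.
move=> xy; apply/idP/idP; last exact: same_orbit_trans.
by apply: same_orbit_trans; apply: same_orbit_sym.
Qed.

(** The action is free, so every orbit has as many elements as the dihedral
    group, 4n. *)
Lemma card_sporadic_orbits :
  #|equivalence_partition (@same_orbit n) sporadic_patterns| * (2 * (2 * n)) =
  2 * ((2 ^ p - 2) * (2 ^ q - 2)).
Proof.
rewrite -card_sporadic_patterns; apply/esym/card_uniform_partition; last first.
  by apply: equivalence_partitionP => x y z _ _ _; apply: same_orbit_equivalence.
move=> _ /imsetP[e /sporadic_patternsP es ->].
have -> : [set e' in sporadic_patterns | same_orbit e e'] =
    (fun g => act g e) @: [set: bool * Z].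
  apply/setP => e'; apply/setIdP/imsetP => [[_ /same_orbitP[g ->]]|[g _ ->]].
    by exists g.
  split; last by apply/same_orbitP; exists g.
  by apply/sporadic_patternsP/sporadic_act.
rewrite card_imset; last exact: act_inj.
by rewrite cardsT card_prod card_bool card_ord Zp_cast // double_gt1.
Qed.

Lemma composition_parts c : is_composition n c ->
  exists b : n.-bseq 'I_n.+1, parts b = c.
Proof.
case/andP=> c0 /eqP cn.
have sc : size [seq (inord k : 'I_n.+1) | k <- c] <= n.
  by rewrite size_map -count_word -cn -(size_word c0) count_size.
exists (Bseq sc); rewrite /parts /= -map_comp map_id_in // => k kc /=.
rewrite inordK // ltnS -cn; elim: (c) kc => //= l c' IH.
by rewrite inE => /predU1P[->|/IH/leq_trans->] //; rewrite ?leq_addr ?leq_addl.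
Qed.

(** A sporadic composition is sent to some colouring that encodes it. *)
Lemma E1_orbits :
  E1 n = #|equivalence_partition (@same_orbit n) sporadic_patterns|.
Proof.
pose f (c : n.-bseq 'I_n.+1) : {ffun Z -> bool} :=
  odflt [ffun=> false] [pick e | `[< sporadic_pattern e /\ encodes e (parts c) >]].
have comp c : c \in sporadic_set n -> is_composition n (parts c).
  by rewrite inE => /asboolP[[]].
have fP c : c \in sporadic_set n -> sporadic_pattern (f c) /\ encodes (f c) (parts c).
  move=> cS; have := cS; rewrite inE => /asboolP/(sporadicP (comp c cS))[e es ec].
  by rewrite /f; case: pickP => [e' /asboolP //|/(_ e)/asboolP[]].
apply: (card_equivalence_partition_transfer (f := f)).
- exact: same_orbit_equivalence.
- by move=> c /fP[fs _]; apply/sporadic_patternsP.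
- move=> c d cS dS; have [[cn _ _ _] ce] := fP c cS; have [[dn _ _ _] de] := fP d dS.
  by apply: dihedral_encodes; rewrite ?comp.
move=> e /sporadic_patternsP es.
have [en _ _ _] := es; have [c [k [Hc ec]]] := encodes_surj n_gt0 en.
have [b bc] := composition_parts Hc; rewrite -bc in Hc ec.
have es' := sporadic_act (false, k) es.
have bS : b \in sporadic_set n.
  by rewrite inE; apply/asboolP/sporadicP => //; exists (act (false, k) e).
exists b => //; have [[fn _ _ _] fe] := fP b bS.
apply: (@same_orbit_trans _ (act (false, k) e)); last first.
  by apply/same_orbit_sym/same_orbitP; exists (false, k).
apply: same_jumps_orbit => //; first by case: es'.
by move=> x; rewrite -fe -ec.
Qed.

End TwoPrimes.

(** * The number of sporadic Reinhardt polygons *)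

Local Open Scope nat_scope.

Lemma dvdn_fermat p : prime p -> odd p -> p %| 2 ^ p.-1 - 1.
Proof.
move=> p_prime p_odd; have p_gt0 := prime_gt0 p_prime.
rewrite -(@Gauss_dvdr _ 2) ?coprimen2 // mulnBr muln1 -expnS prednK //.
by rewrite -eqn_mod_dvd ?fermat_little // -{1}(expn1 2) leq_pexp2l.
Qed.

Theorem theorem1p3 (p q : nat) (p_prime : prime p) (q_prime : prime q)
    (p_odd : odd p) (q_odd : odd q) (p_neq_q : p <> q) :
  E1 (2 * p * q) = fermat_quotient 2 p * fermat_quotient 2 q /\
  ((E1 (2 * p * q))%:R =
     (2 ^+ (p - 1) - 1) * (2 ^+ (q - 1) - 1) / (p%:R * q%:R) :> rat)%R.
Proof.
have p_gt0 := prime_gt0 p_prime; have q_gt0 := prime_gt0 q_prime.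
have H : E1 (2 * p * q) * (p * q) = (2 ^ p.-1 - 1) * (2 ^ q.-1 - 1).
  (* Both sides of the orbit count have a factor 8. *)
  have := card_sporadic_orbits p_prime q_prime p_odd q_odd p_neq_q.
  rewrite -E1_orbits // -(prednK p_gt0) -(prednK q_gt0) !expnS /=.
  by rewrite -!(mulnBr 2 _ 1); nia.
split.
  apply/eqP; rewrite -(@eqn_pmul2r (p * q)) ?muln_gt0 ?p_gt0 // H.
  by rewrite /fermat_quotient mulnACA !divnK ?dvdn_fermat.
have pq0 : (p%:R * q%:R != 0 :> rat)%R by rewrite mulf_neq0 // pnatr_eq0 -lt0n.
apply: (mulIf pq0); rewrite divfK // -!natrM H natrM !natrB ?expn_gt0 //.
by rewrite !natrX !subn1.
Qed.
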